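(* Let ${\cal U} = (U, I)$ be any model of the first-order theory with identity $\mathrm{ZF}$. Then ${\cal U}$ (with the translation of membership given by $I$) is a transitive model of the first-order theory without identity $Z\Phi$.
   Context: **Interpretations and models.** An interpretation for a language $\mathcal L$ is an ordered pair ${\cal U}=(U,I)$, where $U$ is the universe of ${\cal U}$ and $I$ is the interpretation function, mapping the symbols of $\mathcal L$ to appropriate relations, functions and constants in $U$. If all translated axioms of a first-order theory hold in ${\cal U}$, then ${\cal U}$ is a model of that theory. In models of $\mathrm{ZF}$ the predicate $=$ is translated as identity. The translation of $\in$ is written $\in_U$. **Transitivity.** An interpretation ${\cal U}=(U,I)$ of the language of set theory is transitive iff, for any $x$ and any $y$, ''$x$ belonging to $U$ and $y$ belonging to $x$'' entail ''$y$ belonging to $U$'', where ''belonging'' is the translation of $\in$ by means of $I$. **$\mathrm{ZF}$.** First-order theory with identity $=$ and one binary predicate letter $\in$; proper axioms: - ZF1 (Extensionality): $\forall x\forall y(\forall z(z\in x\Leftrightarrow z\in y)\Rightarrow x=y)$. - ZF2 (Empty Set): $\exists x\forall y(y\notin x)$. - ZF3 (Pair): $\forall x\forall y\exists z\forall t(t\in z\Leftrightarrow(t=x\vee t=y))$. - ZF4 (Power): $\forall x\exists y\forall t(t\in y\Leftrightarrow t\subseteq x)$, where $t\subseteq x$ abbreviates $\forall r(r\in t\Rightarrow r\in x)$. - ZF5 (Union): $\forall x\exists y\forall z(z\in y\Leftrightarrow\exists w(z\in w\wedge w\in x))$. - ZF6 (Separation scheme): $\forall z\exists x\forall y(y\in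 x\Leftrightarrow y\in z\wedge\mathcal F(y))$, for each formula $\mathcal F(y)$ with no free occurrences of $x$. - ZF7 (Infinity): $\exists x(\varnothing\in x\wedge\forall y(y\in x\Rightarrow S(y)\in x))$, where $\varnothing$ is the empty set and $S(y)=y\cup\{y\}$. - ZF8 (Replacement scheme): $\forall x\exists!y\,\mathcal F(x,y)\Rightarrow\forall z\exists w\forall t(t\in w\Leftrightarrow\exists s(s\in z\wedge\mathcal F(s,t)))$, for each formula $\mathcal F(x,y)$ in which all occurrences of $x$ and $y$ are free, where $\exists!y\,\mathcal F(x,y)$ means $\exists y(\mathcal F(x,y)\wedge\forall z(\mathcal F(x,z)\Rightarrow y=z))$. - ZF9 (Regularity): $\forall x(x\neq\varnothing\Rightarrow\exists y(y\in x\wedge x\cap y=\varnothing))$. **$Z\Phi$.** First-order theory without identity, with the single primitive binary predicate letter $\in$. Its proper axioms are ZF2–ZF9 (not ZF1), with every occurrence of a formula $x=y$ replaced by $\forall t(t\in x\Leftrightarrow t\in y)$ and every occurrence of $x\neq y$ replaced by $\exists t((t\in x\wedge t\notin y)\vee(t\in y\wedge t\notin x))$. Formulas $\mathcal F$ in the schemes are formulas of the language with $\in$ only. The defined terms $\varnothing$, $S(y)$, $\cap$ are unfolded in terms of $\in$: ''$\varnothing\in x$'' means that some $e\in x$ has no elements, and ''$S(y)\in x$'' means that there is $s\in x$ with $\forall t(t\in s\Leftrightarrow(t\in y\vee\forall r(r\in t\Leftrightarrow r\in y)))$. *)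

(* Defs.v *)
From mathcomp Require Import all_boot.

Set Implicit Arguments.
Unset Strict Implicit.
Unset Printing Implicit Defensive.

(* First-order formulas with the binary predicate letter \in, over named
   variables. The flag [idt] says whether the language has the identity
   predicate: [formula true] is the language with \in and =, and
   [formula false], in which [Eq] cannot be used, the one with \in only. *)

Notation var := nat.

Inductive formula (idt : bool) : Type :=
  | Mem of var & var
  | Eq of idt & var & var
  | Not of formula idt
  | And of formula idt & formula idt
  | Or of formula idt & formula idt
  | Imp of formula idt & formula idt
  | All of var & formula idt
  | Ex of var & formula idt.

Arguments Mem {idt}.

Definition Iff idt (F G : formula idt) := And (Imp F G) (Imp G F).

Fixpoint free idt (v : var) (F : formula idt) : bool :=
  match F with
  | Mem a b | Eq _ a b => (v == a) || (v == b)
  | Not G => free v G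
  | And G H | Or G H | Imp G H => free v G || free v H
  | All a G | Ex a G => (v != a) && free v G
  end.

Fixpoint bound idt (v : var) (F : formula idt) : bool :=
  match F with
  | Mem _ _ | Eq _ _ _ => false
  | Not G => bound v G
  | And G H | Or G H | Imp G H => bound v G || bound v H
  | All a G | Ex a G => (v == a) || bound v G
  end.

Definition occurs idt (v : var) (F : formula idt) := free v F || bound v F.

(* Replaces every occurrence of each variable, quantified ones included. This
   is substitution only for formulas in which the variables moved by [f] are
   not bound and their images do not occur. *)
Fixpoint rename idt (f : var -> var) (F : formula idt) : formula idt :=
  match F with
  | Mem a b => Mem (f a) (f b)
  | Eq h a b => Eq h (f a) (f b)
  | Not G => Not (rename f G)
  | And G H => And (rename f G) (rename f H)
  | Or G H => Or (rename f G) (rename f H)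
  | Imp G H => Imp (rename f G) (rename f H)
  | All a G => All (f a) (rename f G)
  | Ex a G => Ex (f a) (rename f G)
  end.

Declare Scope formula_scope.
Delimit Scope formula_scope with form.
Bind Scope formula_scope with formula.

Notation "v ∈ w" := (Mem v w) (at level 70, no associativity) : formula_scope.
Notation "v ∉ w" := (Not (Mem v w))
  (at level 70, no associativity) : formula_scope.
Notation "~ F" := (Not F) : formula_scope.
Notation "F /\ G" := (And F G) : formula_scope.
Notation "F \/ G" := (Or F G) : formula_scope.
Notation "F -> G" := (Imp F G) : formula_scope.
Notation "F <-> G" := (Iff F G) : formula_scope.
Notation "∀ v , F" := (All v F) (at level 200, F at level 200) : formula_scope.
Notation "∃ v , F" := (Ex v F) (at level 200, F at level 200) : formula_scope.

(* In the language without identity, = and <> stand for formulas in \in; the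
   bound variable is chosen distinct from [v] and [w]. *)
Definition equal idt (v w : var) : formula idt :=
  match idt with
  | true => @Eq true isT v w
  | false => let t := (maxn v w).+1 in (∀ t, (t ∈ v <-> t ∈ w))%form
  end.

Definition unequal idt (v w : var) : formula idt :=
  match idt with
  | true => Not (@Eq true isT v w)
  | false => let t := (maxn v w).+1 in
      (∃ t, ((t ∈ v /\ t ∉ w) \/ (t ∈ w /\ t ∉ v)))%form
  end.

Notation "v = w" := (equal _ v w) : formula_scope.
Notation "v <> w" := (unequal _ v w) : formula_scope.

Module Ax.

Definition x : var := 0.
Definition y : var := 1.
Definition z : var := 2.
Definition t : var := 3.
Definition r : var := 4.
Definition w : var := 5.
Definition s : var := 6.
Definition e : var := 7.
Definition i : var := 8.

(* A defined term is eliminated by asserting the existence of a set having its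
   defining property: e stands for the empty set in infinity and regularity,
   s for the successor of y in infinity, i for the intersection of x and y in
   regularity. *)

Definition extensionality : formula true :=
  ∀ x, ∀ y, ((∀ z, (z ∈ x <-> z ∈ y)) -> x = y).

Definition empty_set idt : formula idt := ∃ x, ∀ y, y ∉ x.

Definition pair idt : formula idt :=
  ∀ x, ∀ y, ∃ z, ∀ t, (t ∈ z <-> (t = x \/ t = y)).

Definition power idt : formula idt :=
  ∀ x, ∃ y, ∀ t, (t ∈ y <-> ∀ r, (r ∈ t -> r ∈ x)).

Definition union idt : formula idt :=
  ∀ x, ∃ y, ∀ z, (z ∈ y <-> ∃ w, (z ∈ w /\ w ∈ x)).

Definition separation idt (F : formula idt) : formula idt :=
  ∀ z, ∃ x, ∀ y, (y ∈ x <-> (y ∈ z /\ F)).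

Definition infinity idt : formula idt :=
  ∃ x, ((∃ e, (e ∈ x /\ ∀ r, r ∉ e)) /\
        ∀ y, (y ∈ x ->
              ∃ s, (s ∈ x /\ ∀ t, (t ∈ s <-> (t ∈ y \/ t = y))))).

Definition replacement idt (F : formula idt) : formula idt :=
  let F_xz := rename [eta id with y |-> z] F in
  let F_st := rename [eta id with x |-> s, y |-> t] F in
  (∀ x, ∃ y, (F /\ ∀ z, (F_xz -> y = z))) ->
  ∀ z, ∃ w, ∀ t, (t ∈ w <-> ∃ s, (s ∈ z /\ F_st)).

Definition regularity idt : formula idt :=
  ∀ x, ((∃ e, ((∀ r, r ∉ e) /\ x <> e)) ->
        ∃ y, (y ∈ x /\
              ∃ i, ((∀ t, (t ∈ i <-> (t ∈ x /\ t ∈ y))) /\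
                    ∃ e, ((∀ r, r ∉ e) /\ i = e)))).

End Ax.

(* The axioms common to the theories with and without identity. Formulas of
   the schemes may have parameters, an axiom with free variables being
   understood as its universal closure. *)
Inductive common_axiom (idt : bool) : formula idt -> Prop :=
  | Empty_set : common_axiom (Ax.empty_set idt)
  | Pair : common_axiom (Ax.pair idt)
  | Power : common_axiom (Ax.power idt)
  | Union : common_axiom (Ax.union idt)
  | Separation (F : formula idt) :
      ~~ free Ax.x F -> common_axiom (Ax.separation F)
  | Infinity : common_axiom (Ax.infinity idt)
  | Replacement (F : formula idt) :
      ~~ bound Ax.x F -> ~~ bound Ax.y F ->
      ~~ occurs Ax.z F -> ~~ occurs Ax.w F ->
      ~~ occurs Ax.s F -> ~~ occurs Ax.t F ->
      common_axiom (Ax.replacement F)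
  | Regularity : common_axiom (Ax.regularity idt).

Inductive ZF : formula true -> Prop :=
  | ZF_extensionality : ZF Ax.extensionality
  | ZF_common F : common_axiom F -> ZF F.

Definition ZPhi : formula false -> Prop := @common_axiom false.

(* The universe is a nonempty class of objects of an ambient type [V], so that
   belonging to the universe is a property and not a typing judgement; \in is
   interpreted by a relation in the universe. *)
Record interpretation (V : Type) := Interpretation {
  universe : V -> Prop;
  mem_in : V -> V -> Prop;
  universe_nonempty : exists a, universe a;
  mem_in_universe : forall a b, mem_in a b -> universe a /\ universe b
}.

Definition update V (rho : var -> V) (v : var) (a : V) : var -> V :=
  fun u => if u == v then a else rho u.

Fixpoint sat V (U : interpretation V) idt (rho : var -> V) (F : formula idt) :
    Prop :=
  match F with
  | Mem v w => mem_in U (rho v) (rho w)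
  | Eq _ v w => rho v = rho w
  | Not G => ~ sat U rho G
  | And G H => sat U rho G /\ sat U rho H
  | Or G H => sat U rho G \/ sat U rho H
  | Imp G H => sat U rho G -> sat U rho H
  | All v G => forall a, universe U a -> sat U (update rho v a) G
  | Ex v G => exists2 a, universe U a & sat U (update rho v a) G
  end.

Definition holds V (U : interpretation V) idt (F : formula idt) :=
  forall rho : var -> V, (forall v, universe U (rho v)) -> sat U rho F.

Definition is_model V (U : interpretation V) idt (T : formula idt -> Prop) :=
  forall F, T F -> holds U F.

Definition is_transitive V (U : interpretation V) :=
  forall a b : V, universe U a -> mem_in U b a -> universe U b.

(* Main.v *)
(* Extensionality makes the formula replacing v = w in ZPhi equivalent to
   identity in the model, and likewise for v <> w (classically). A formula of
   the language without identity is also one of the language with identity,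
   with the same meaning, so every axiom of ZPhi is equivalent in the model to
   the same axiom of ZF, the schemes included. *)

From mathcomp Require Import all_boot.
From Stdlib Require Import Classical.
Require Import Defs.

Set Implicit Arguments.
Unset Strict Implicit.
Unset Printing Implicit Defensive.

(** The inclusion of the language with ∈ only into the language with identity. In [formula false]
    the constructor [Eq] carries a proof of [false], so its branch is vacuous. *)
Fixpoint with_identity (F : formula false) : formula true :=
  match F with
  | Mem v w => Mem v w
  | Eq _ v w => @Eq true isT v w
  | Not G => Not (with_identity G)
  | And G H => And (with_identity G) (with_identity H)
  | Or G H => Or (with_identity G) (with_identity H)
  | Imp G H => Imp (with_identity G) (with_identity H)
  | All v G => All v (with_identity G)
  | Ex v G => Ex v (with_identity G)
  end.

(** Used with the next two lemmas to carry the variable conditions of separation and replacement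
    over to [with_identity F]. *)
Lemma free_with_identity v F : free v (with_identity F) = free v F.
Proof. by elim: F => //= [G -> H ->|G -> H ->|G -> H ->|w G ->|w G ->]. Qed.

Lemma bound_with_identity v F : bound v (with_identity F) = bound v F.
Proof. by elim: F => //= [G -> H ->|G -> H ->|G -> H ->|w G ->|w G ->]. Qed.

Lemma occurs_with_identity v F : occurs v (with_identity F) = occurs v F.
Proof. by rewrite /occurs free_with_identity bound_with_identity. Qed.

Lemma rename_with_identity f F :
  rename f (with_identity F) = with_identity (rename f F).
Proof.
by elim: F => //= [G ->|G -> H ->|G -> H ->|G -> H ->|v G ->|v G ->].
Qed.

Lemma update_universe V (U : interpretation V) rho v a :
  (forall u, universe U (rho u)) -> universe U a ->
  forall u, universe U (update rho v a u).
Proof. by move=> Urho Ua u; rewrite /update; case: eqP. Qed.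

Lemma update_eq V (rho : var -> V) v a : update rho v a v = a.
Proof. by rewrite /update eqxx. Qed.

Lemma update_neq V (rho : var -> V) v u a : u != v -> update rho v a u = rho u.
Proof. by rewrite /update => /negbTE->. Qed.

Lemma model_extensionality V (U : interpretation V) a b :
  holds U Ax.extensionality -> universe U a -> universe U b ->
  (forall c, universe U c -> mem_in U c a <-> mem_in U c b) -> a = b.
Proof.
move=> Uext Ua Ub eq_ab.
(* The axiom is a sentence, so any valuation in the universe will do; the constant one is at
   hand. *)
have := Uext (fun=> a) (fun=> Ua) a Ua b Ub; rewrite /= /update /=; apply.
by move=> c Uc; have [] := eq_ab c Uc.
Qed.

(** The two formulas may belong to different languages. Valuations are confined to the universe:
    objects outside it have no members, so the formula standing for = would identify them all. *)
Definition equivalent V (U : interpretation V) i j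
    (F : formula i) (G : formula j) :=
  forall rho, (forall v, universe U (rho v)) -> sat U rho F <-> sat U rho G.

Section Equivalent.

Variables (V : Type) (U : interpretation V) (i j : bool).
Implicit Types (F : formula i) (G : formula j).

Lemma equivalent_mem v w : equivalent U (@Mem i v w) (@Mem j v w).
Proof. by []. Qed.

Lemma equivalent_not F G : equivalent U F G -> equivalent U (Not F) (Not G).
Proof. by move=> FG rho /FG /= ?; tauto. Qed.

Lemma equivalent_and F G F' G' : equivalent U F G -> equivalent U F' G' ->
  equivalent U (And F F') (And G G').
Proof.
by move=> FG FG' rho Urho; move: (FG _ Urho) (FG' _ Urho) => /=; tauto.
Qed.

Lemma equivalent_or F G F' G' : equivalent U F G -> equivalent U F' G' ->
  equivalent U (Or F F') (Or G G').
Proof.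
by move=> FG FG' rho Urho; move: (FG _ Urho) (FG' _ Urho) => /=; tauto.
Qed.

Lemma equivalent_imp F G F' G' : equivalent U F G -> equivalent U F' G' ->
  equivalent U (Imp F F') (Imp G G').
Proof.
by move=> FG FG' rho Urho; move: (FG _ Urho) (FG' _ Urho) => /=; tauto.
Qed.

Lemma equivalent_iff F G F' G' : equivalent U F G -> equivalent U F' G' ->
  equivalent U (Iff F F') (Iff G G').
Proof. by move=> FG FG'; apply: equivalent_and; apply: equivalent_imp. Qed.

(** Quantifiers range over the universe, so an updated valuation still takes its values there. *)
Lemma equivalent_all v F G : equivalent U F G ->
  equivalent U (All v F) (All v G).
Proof.
move=> FG rho Urho.
by split=> /= satF a Ua; apply/FG; [exact: update_universe | exact: satF
  | exact: update_universe | exact: satF].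
Qed.

Lemma equivalent_ex v F G : equivalent U F G -> equivalent U (Ex v F) (Ex v G).
Proof.
move=> FG rho Urho.
by split=> /= -[a Ua satF]; exists a => //; apply/FG => //;
  exact: update_universe.
Qed.

End Equivalent.

Lemma equivalent_with_identity V (U : interpretation V) F :
  equivalent U F (with_identity F).
Proof.
elim: F => //= [G|G IHG H|G IHG H|G IHG H|v G|v G].
- exact: equivalent_not.
- exact: equivalent_and.
- exact: equivalent_or.
- exact: equivalent_imp.
- exact: equivalent_all.
- exact: equivalent_ex.
Qed.

Lemma equivalent_equal V (U : interpretation V) v w :
  holds U Ax.extensionality -> equivalent U (equal false v w) (equal true v w).
Proof.
move=> Uext rho Urho /=; set t := (maxn v w).+1.
(* The bound variable [t] exceeds [v] and [w], so updating it leaves their values unchanged. *)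
have vt : v != t by rewrite neq_ltn ltnS leq_maxl.
have wt : w != t by rewrite neq_ltn ltnS leq_maxr.
split=> [eq_vw | eq_vw a _]; last by rewrite update_eq !update_neq // eq_vw.
apply: (model_extensionality Uext) => // a /eq_vw.
by rewrite update_eq !update_neq.
Qed.

Lemma equivalent_unequal V (U : interpretation V) v w :
  holds U Ax.extensionality ->
  equivalent U (unequal false v w) (unequal true v w).
Proof.
move=> Uext rho Urho /=; set t := (maxn v w).+1.
have vt : v != t by rewrite neq_ltn ltnS leq_maxl.
have wt : w != t by rewrite neq_ltn ltnS leq_maxr.
split=> [[a _] | neq_vw].
  by rewrite update_eq !update_neq // => + eq_vw; rewrite eq_vw; tauto.
(* By contradiction: if no element separates the two sets, they have the same elements, hence are
   identical by extensionality. *)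
apply: NNPP => no_witness; apply: neq_vw.
apply: (model_extensionality Uext) => // a Ua; apply: NNPP => neq_a.
by apply: no_witness; exists a; rewrite // update_eq !update_neq //; tauto.
Qed.

(* The formulas for = and <> must be tried before the quantifiers and
   connectives that they unfold to. *)
Ltac equivalent_congr Uext :=
  repeat first
    [ exact: (equivalent_equal _ _ Uext) | exact: (equivalent_unequal _ _ Uext)
    | exact: equivalent_mem | exact: equivalent_with_identity
    | apply: equivalent_all | apply: equivalent_ex | apply: equivalent_iff
    | apply: equivalent_and | apply: equivalent_or | apply: equivalent_imp
    | apply: equivalent_not ].

Lemma common_axiom_with_identity V (U : interpretation V) (A : formula false) :
  holds U Ax.extensionality -> common_axiom A ->
  exists2 B : formula true, common_axiom B & equivalent U A B.
Proof.
move=> Uext.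
case=> [||||F Fx||F Fx Fy Fz Fw Fs Ft|].
- by exists (Ax.empty_set true); [exact: Empty_set | equivalent_congr Uext].
- by exists (Ax.pair true); [exact: Pair | equivalent_congr Uext].
- by exists (Ax.power true); [exact: Power | equivalent_congr Uext].
- by exists (Ax.union true); [exact: Union | equivalent_congr Uext].
- exists (Ax.separation (with_identity F)).
    by apply: Separation; rewrite free_with_identity.
  by equivalent_congr Uext.
- by exists (Ax.infinity true); [exact: Infinity | equivalent_congr Uext].
- exists (Ax.replacement (with_identity F)).
    by apply: Replacement; rewrite ?occurs_with_identity ?bound_with_identity.
  (* Replacement also contains renamed copies of [F]; commuting [rename] with the inclusion makes
     [equivalent_with_identity] applicable to them. *)
  by rewrite /Ax.replacement !rename_with_identity; equivalent_congr Uext.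
- by exists (Ax.regularity true); [exact: Regularity | equivalent_congr Uext].
Qed.

Theorem proposition1 (V : Type) (U : interpretation V) :
  is_model U ZF -> is_transitive U /\ is_model U ZPhi.
Proof.
move=> UZF; split=> [a b _ ba | A Aax rho Urho].
  (* Transitivity is immediate, as [mem_in] relates only elements of the universe. *)
  by have [] := mem_in_universe ba.
have [B Bax AB] := common_axiom_with_identity (UZF _ ZF_extensionality) Aax.
by apply/AB => //; apply: (UZF _ (ZF_common Bax)).
Qed.
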